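(* For positive integers $k,p,r$: \[ \eta(\{1\}_{r-1},k;p)=(-1)^{r-1}\sum_{j=1}^r\sum_{\substack{k_1+\cdots+k_j=k+j-1\\ k_1,\ldots,k_j\ge1}}\binom{p+r-j-1}{p-1}\eta(k_1,\ldots,k_j;p+r-j) \] and \[ \sum_{\substack{k_1+\cdots+k_r=k+r-1\\ k_1,\ldots,k_r\ge1}}\eta(k_1,\ldots,k_r;p)=(-1)^{r-1}\sum_{j=1}^r\binom{p+r-j-1}{p-1}\eta(\{1\}_{j-1},k;p+r-j). \]
   Context: ${\rm Li}_{k_1,\ldots,k_r}(z)=\sum_{1\le n_1<\cdots<n_r}\frac{z^{n_r}}{n_1^{k_1}\cdots n_r^{k_r}}$ (for $z\le0$ understood via its analytic continuation / iterated integral representation). Kaneko–Tsumura $\eta$-function: $\eta(k_1,\ldots,k_r;s)=\frac{1}{\Gamma(s)}\int_0^\infty\frac{t^{s-1}}{1-e^t}{\rm Li}_{k_1,\ldots,k_r}(1-e^t)\,dt$. $\{1\}_j$ denotes $j$ repetitions of $1$. *)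

(* Defs.v *)
From mathcomp Require Import all_boot all_order all_algebra.
From mathcomp Require Import all_classical all_reals all_analysis.

Set Implicit Arguments.
Unset Strict Implicit.
Unset Printing Implicit Defensive.

Import Order.TTheory GRing.Theory Num.Theory.

Local Open Scope classical_set_scope.
Local Open Scope ring_scope.

(* The oriented integral of f from 0 to z. *)
Definition int0 {R : realType} (f : R -> R) (z : R) : R :=
  if 0 <= z then \int[@lebesgue_measure R]_(t in `[0, z]) f t
  else - \int[@lebesgue_measure R]_(t in `[z, 0]) f t.

(* Li_{k_1,...,k_r} on ]-oo, 1[, given the reversed index k_r :: ... :: k_1,
   through its iterated integral representation, i.e. the solution, vanishing
   at 0, of
     Li_{k_1,...,k_r}'(z)     = Li_{k_1,...,k_r - 1}(z) / z     if k_r > 1,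
     Li_{k_1,...,k_{r-1},1}'(z) = Li_{k_1,...,k_{r-1}}(z) / (1 - z),
   with Li = 1 for the empty index.  This is the analytic continuation of
   \sum_(1 <= n_1 < ... < n_r) z^n_r / (n_1^k_1 ... n_r^k_r).  The entries of
   the index are meant to be positive.  The value given to f t / t at t = 0 is
   irrelevant to the integral. *)
Fixpoint polylog_rev {R : realType} (ks : seq nat) : R -> R :=
  if ks is k :: ks' then
    iter k.-1 (fun f : R -> R => int0 (fun t => f t / t))
      (int0 (fun t => polylog_rev ks' t / (1 - t)))
  else fun=> 1.

(* [:: k_1; ...; k_r] is the index with 1 <= n_1 < ... < n_r, so that the
   outermost integrations are those of k_r. *)
Definition polylog {R : realType} (ks : seq nat) : R -> R :=
  polylog_rev (rev ks).

Definition Gamma {R : realType} (s : R) : R :=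
  \int[@lebesgue_measure R]_(t in `]0, +oo[) (t `^ (s - 1) * expR (- t)).

(* The Kaneko-Tsumura eta function at a real argument s > 0. *)
Definition eta {R : realType} (ks : seq nat) (s : R) : R :=
  (Gamma s)^-1 *
  \int[@lebesgue_measure R]_(t in `]0, +oo[)
     (t `^ (s - 1) / (1 - expR t) * polylog ks (1 - expR t)).

Definition is_composition (n : nat) (ks : seq nat) : bool :=
  all (fun k => 0 < k)%N ks && (sumn ks == n).

(* The sum of F [:: k_1; ...; k_j] over k_1, ..., k_j >= 1 with
   k_1 + ... + k_j = n; the bound n.+1 on the entries is no restriction. *)
Definition sum_compositions {R : realType} (n j : nat) (F : seq nat -> R) : R :=
  \sum_(ks : j.-tuple 'I_n.+1 | is_composition n [seq nat_of_ord i | i <- ks])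
     F [seq nat_of_ord i | i <- ks].

(* Main.v *)
Require Import Defs.
From mathcomp Require Import all_boot all_order all_algebra.
From mathcomp Require Import all_classical all_reals all_analysis.
From mathcomp Require Import measurable_realfun zify ring lra.

(* Put z = 1 - e^t in the polylogarithms, L_{k_1,...,k_r}(t) = Li_{k_1,...,k_r}(1 - e^t).
   Then L_{...,1}' = - L_{...} and L_{...,k+1}' = e^t / (e^t - 1) L_{...,k}, and both
   identities follow from pointwise ones, valid for every t > 0: with S_j(t) the sum of
   L_{k_1,...,k_j}(t) over k_1 + ... + k_j = k + j - 1,
     L_{{1}_{r-1},k} = (-1)^(r-1) \sum_(j=1)^r t^(r-j)/(r-j)! S_j,
     S_r = (-1)^(r-1) \sum_(j=1)^r t^(r-j)/(r-j)! L_{{1}_{j-1},k}.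
   By induction on k the two sides have the same derivative (the sums telescope), and
   they vanish at 0.  Integrating against t^(p-1)/(p-1)! / (1 - e^t), the product
   t^(p-1)/(p-1)! * t^(r-j)/(r-j)! produces the binomial coefficient and the argument
   p + r - j.  The integrals converge as |L(t)| <= t (1 + t)^n for some n. *)

Import Order.TTheory GRing.Theory Num.Theory.
Import numFieldNormedType.Exports.

Local Open Scope classical_set_scope.
Local Open Scope ring_scope.

(** * Compositions *)

Definition incr_head (ks : seq nat) : seq nat :=
  if ks is k :: ks' then k.+1 :: ks' else [::].

(* The compositions of n into j parts, written with the last part first. *)
Fixpoint rcomps (n j : nat) : seq (seq nat) :=
  match n, j with
  | 0, 0 => [:: [::]]
  | n'.+1, j'.+1 =>
      [seq 1%N :: ks | ks <- rcomps n' j'] ++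
      [seq incr_head ks | ks <- rcomps n' j'.+1]
  | _, _ => [::]
  end.

(** Parts are positive, so a head equal to 1 can only come from the first half of the recursion and
    a head of at least 2 only from the second. *)
Lemma mem_rcomps n j ks :
  (ks \in rcomps n j) = (size ks == j) && is_composition n ks.
Proof.
rewrite /is_composition.
elim: n j ks => [|n IH] [|j] ks /=.
- by case: ks => [|[|k] ks] //=; rewrite ?inE ?andbF.
- by rewrite in_nil; case: ks => [|[|k] ks]; rewrite //= ?addSn ?andbF.
- by rewrite in_nil; case: ks => [|k ks].
- rewrite mem_cat; case: ks => [|[|[|k]] ks] /=.
  + by apply/negbTE; rewrite negb_or; apply/andP; split;
      apply/negP => /mapP[[|x s]] //; rewrite IH.
  + rewrite andbF; apply/negbTE; rewrite negb_or; apply/andP; split;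
      by apply/negP => /mapP[[|x s]].
  + rewrite mem_map => [|? ? []//]; rewrite IH add1n !eqSS.
    case: (X in _ || X) / mapP => [[[|[|x] s]]//|_]; last by rewrite orbF.
    by rewrite IH /= andbF.
  + have -> : (k.+2 :: ks \in [seq 1%N :: ks0 | ks0 <- rcomps n j]) = false.
      by apply/negP => /mapP[].
    have -> : k.+2 :: ks = incr_head (k.+1 :: ks) by [].
    apply/mapP/idP => [[[|x s]]|h].
    * by rewrite IH.
    * by rewrite IH => h /= [-> ->]; move: h; rewrite /= !addSn !eqSS => /and3P[-> /andP[_ ->] ->].
    * by exists (k.+1 :: ks); rewrite // IH; move: h; rewrite /= !addSn !eqSS.
Qed.

Lemma rcomps_uniq n j : uniq (rcomps n j).
Proof.
elim: n j => [|n IH] [|j] //=.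
rewrite cat_uniq map_inj_uniq => [|? ? []//]; rewrite IH /=.
rewrite map_inj_in_uniq ?IH ?andbT.
  apply/hasPn => _ /mapP[[|x s] + ->]; rewrite mem_rcomps // => /andP[_ /andP[/= /andP[x0 _] _]].
  by apply/negP => /mapP[? _ [x1]]; move: x0; rewrite x1.
move=> [|x s] [|y u]; rewrite !mem_rcomps //= => _ _ [-> ->] //.
Qed.

(** The sum of positive parts is at least their number. *)
Lemma rcomps_nil n : rcomps n n.+1 = [::].
Proof.
case E : (rcomps n n.+1) => [//|ks s].
have : ks \in rcomps n n.+1 by rewrite E mem_head.
rewrite mem_rcomps => /andP[/eqP sk /andP[pos /eqP sn]].
suff : (size ks <= sumn ks)%N by rewrite sk sn ltnn.
elim: ks pos {sk sn E} => //= k ks IHk /andP[k0 /IHk h].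
by rewrite -add1n leq_add.
Qed.

(** Both sides run over duplicate-free enumerations of the same compositions; [rev] appears because
    [rcomps] lists the last part first. *)
Lemma sum_compositionsE {R : realType} n j (F : seq nat -> R) :
  sum_compositions n j F = \sum_(ks <- rcomps n j) F (rev ks).
Proof.
rewrite /sum_compositions -(big_map rev xpredT F).
pose val_seq (ks : j.-tuple 'I_n.+1) := [seq nat_of_ord i | i <- ks].
rewrite -(big_map val_seq (is_composition n) F).
rewrite -big_filter; apply/perm_big/uniq_perm.
- rewrite filter_uniq // map_inj_uniq ?index_enum_uniq //.
  by move=> s t /(inj_map (@ord_inj _)) /val_inj.
- by rewrite map_inj_uniq ?rcomps_uniq //; exact: can_inj revK.
move=> ks; rewrite mem_filter.
have crev : is_composition n (rev ks) = is_composition n ks.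
  by rewrite /is_composition all_rev (perm_sumn (permEl (perm_rev ks))).
have -> : (ks \in [seq rev i | i <- rcomps n j]) = (size ks == j) && is_composition n ks.
  by rewrite -[ks]revK mem_map ?mem_rcomps ?size_rev ?revK ?crev //; exact: can_inj revK.
apply/andP/andP => -[].
  by move=> cks /mapP[t _ e]; split=> //; rewrite e size_map size_tuple.
move=> /eqP sk cks; split=> //; apply/mapP.
(* Each part is at most the sum [n], so [inord] loses nothing. *)
have ub : all (fun k => k < n.+1)%N ks.
  move: cks => /andP[_ /eqP <-]; elim: ks {sk crev} => //= k s IHs.
  rewrite ltnS leq_addr /=; apply/allP => x /(allP IHs).
  by rewrite !ltnS => /leq_trans; apply; rewrite leq_addl.
have st : size [seq (inord k : 'I_n.+1) | k <- ks] == j by rewrite size_map sk.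
exists (Tuple st); first by rewrite mem_index_enum.
rewrite /val_seq /= -map_comp -[LHS]map_id.
by apply/eq_in_map => k /(allP ub) kn /=; rewrite inordK.
Qed.

(** * Derivatives and the oriented integral *)

Section Calculus.
Context {R : realType}.
Set Implicit Arguments.
Unset Strict Implicit.
Notation mu := (@lebesgue_measure R).

Lemma is_derive_exp (f : R -> R) (n : nat) (x df : R) : is_derive x 1 f df ->
  is_derive x 1 (fun t => f t ^+ n) (n%:R * f x ^+ n.-1 * df).
Proof. by move=> d; have := is_deriveX n d; rewrite exprfctE. Qed.

Lemma is_derive_mul (f g : R -> R) (x df dg : R) :
  is_derive x 1 f df -> is_derive x 1 g dg ->
  is_derive x 1 (fun t => f t * g t) (df * g x + f x * dg).
Proof.
move=> dF dG; have := is_deriveM dF dG.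
by rewrite /GRing.scale /= addrC [g x * _]mulrC.
Qed.

(** The function is nondecreasing on the positive reals, so [h t] bounds [h s] for small [s], hence
    also the limit at 0. A right limit replaces the value at 0 because derivatives are only known
    for t > 0. *)
Lemma nonneg_of_deriv (h dh : R -> R) :
  (forall t : R, 0 < t -> is_derive t 1 h (dh t)) -> (forall t : R, 0 < t -> 0 <= dh t) ->
  h x @[x --> 0^'+] --> 0 -> forall t : R, 0 < t -> 0 <= h t.
Proof.
move=> hd d0 h0 t t0.
rewrite -(cvg_lim _ h0)//; apply: limr_le; first by apply/cvg_ex; exists 0.
near=> s.
have s0 : 0 < s by [].
have st : s <= t by near: s; exact: nbhs_right_le.
have dh' x : x \in `]0, t + 1[ -> is_derive x 1 h (dh x).
  by rewrite in_itv /= => /andP[x0 _]; exact: hd.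
apply: (@ger0_derive1_le_oo _ h 0 (t + 1)) => //.
- by move=> x xi; have [] := dh' x xi.
- by move=> x xi; rewrite derive1E; have [_ ->] := dh' x xi; rewrite d0 // (itvP xi).
- move=> x; rewrite inE /= => xi; have [d _] := dh' x xi.
  exact/differentiable_continuous/derivable1_diffP.
- by rewrite in_itv /= s0 (le_lt_trans st) // ltrDl.
- by rewrite in_itv /= t0 ltrDl ltr01.
Unshelve. all: by end_near. Qed.

(** Both differences have zero derivative, so [nonneg_of_deriv] gives the two inequalities. Every
    pointwise identity below rests on this uniqueness. *)
Lemma eq_of_deriv (f g d : R -> R) :
  (forall t : R, 0 < t -> is_derive t 1 f (d t)) ->
  (forall t : R, 0 < t -> is_derive t 1 g (d t)) ->
  f x @[x --> 0^'+] --> 0 -> g x @[x --> 0^'+] --> 0 ->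
  forall t : R, 0 < t -> f t = g t.
Proof.
move=> fd gd f0 g0.
have le (u v : R -> R) : (forall t : R, 0 < t -> is_derive t 1 u (d t)) ->
  (forall t : R, 0 < t -> is_derive t 1 v (d t)) ->
  u x @[x --> 0^'+] --> 0 -> v x @[x --> 0^'+] --> 0 ->
  forall t : R, 0 < t -> v t <= u t.
  move=> ud vd u0 v0 t t0; rewrite -subr_ge0.
  apply: (@nonneg_of_deriv (u - v) (fun t => d t - d t)) => //.
  - by move=> s s0; apply: is_deriveB; [exact: ud|exact: vd].
  - by move=> s _; rewrite subrr.
  - by rewrite -[X in _ --> X](subrr 0); apply: cvgB.
by move=> t t0; apply/eqP; rewrite eq_le !le.
Qed.

Lemma integrable_left (g : R -> R) (z M : R) :
  (forall x : R, x < 0 -> {for x, continuous g}) ->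
  (forall x : R, z <= x -> x < 0 -> `|g x| <= M) ->
  mu.-integrable `[z, 0] (EFin \o g).
Proof.
move=> gc gM; apply: measurable_bounded_integrable => //=.
- rewrite lebesgue_measure_itv /= lte_fin; case: ifP => _ //.
  by rewrite -EFinB ltry.
- apply/measurable_fun_itv_bndo_bndcP/measurable_fun_itv_obnd_cbndP.
  apply: open_continuous_measurable_fun => // x.
  by rewrite inE /= in_itv /= => /andP[_ /gc].
(* The hypothesis says nothing about [g 0], an arbitrary value when g is a quotient by z, so it
   enters the bound separately. *)
- exists (Num.max M `|g 0|); split; first exact: num_real.
  move=> N /ltW; rewrite ge_max => /andP[MN gN] x /=; rewrite in_itv /= => /andP[zx].
  rewrite le_eqVlt => /predU1P[-> //|x0].
  by rewrite (le_trans _ MN) // gM.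
Qed.

Lemma int0_neg (g : R -> R) (z : R) : z < 0 ->
  int0 g z = - \int[mu]_(t in `[z, 0]) g t.
Proof. by rewrite /int0 ltNge => /negbTE ->. Qed.

(** The fundamental theorem is applied to the integral [F] from the base point z - 1, left of z;
    near z, [int0 g] differs from [F] by the constant [C]. *)
Lemma is_derive_int0 (g : R -> R) (z : R) : z < 0 ->
  (forall x : R, x < 0 -> {for x, continuous g}) ->
  (forall y : R, y < 0 -> exists M : R, forall x : R, y <= x -> x < 0 -> `|g x| <= M) ->
  is_derive z 1 (int0 g) (g z).
Proof.
move=> z0 gc gb.
have z1 : z - 1 < 0 by rewrite subr_lt0 (lt_trans z0).
have [M gM] := gb _ z1.
have gi := integrable_left gc gM.
pose C := \int[mu]_(t in `[z - 1, 0]) g t.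
pose F y := \int[mu]_(t in `[z - 1, y]) g t.
have zz : z - 1 < z by rewrite ltrBlDr ltrDl.
have [dF F'] := continuous_FTC1_closed z0 gi zz (gc _ z0).
apply: (@near_eq_is_derive _ _ _ (fun y => F y - C)).
  near=> y.
  have y0 : y < 0 by near: y; exact: lt_nbhsl.
  have yz : z - 1 < y by near: y; exact: lt_nbhsr.
  apply/esym; rewrite int0_neg // /F /C -[RHS]opprB; congr (- _).
  rewrite (Rintegral_itvB gi) ?bnd_simp ?ltW // Rintegral_itv_obnd_cbnd //.
  by apply: integrableS gi => //; apply: subset_itv; rewrite bnd_simp ?lexx // ltW.
have dF1 : is_derive z 1 F (g z) by rewrite -F' derive1E; exact/derivableP.
by have := is_deriveB dF1 (is_derive_cst C z 1); rewrite subr0.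
Unshelve. all: by end_near. Qed.

Lemma int0_bound (g : R -> R) (z M : R) : z < 0 ->
  (forall x : R, x < 0 -> {for x, continuous g}) ->
  (forall x : R, z <= x -> x < 0 -> `|g x| <= M) ->
  `|int0 g z| <= M * - z.
Proof.
move=> z0 gc gM; rewrite int0_neg // normrN.
have gi := integrable_left gc gM.
have gi' : mu.-integrable `[z, 0[ (EFin \o g).
  by apply: integrableS gi => //; exact: subset_itv_co_cc.
(* The endpoint 0, where [M] need not bound [g], is dropped. *)
rewrite -Rintegral_itv_bndo_bndc //.
apply: le_trans (le_normr_Rintegral _ gi') _ => //.
have -> : M * - z = \int[mu]_(t in `[z, 0[) (cst M t).
  by rewrite Rintegral_cst // /= lebesgue_measure_itv /= lte_fin z0 /= add0r.
apply: le_Rintegral => //=.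
- exact: integrable_norm.
- apply: measurable_bounded_integrable => //; last exact: bounded_cst.
  by rewrite /= lebesgue_measure_itv /= lte_fin z0 -EFinB ltry.
- by move=> x; rewrite in_itv /= => /andP[]; exact: gM.
Qed.

End Calculus.

(** * The substitution z = 1 - e^t in oriented integrals *)

Section Int0ExpR.
Context {R : realType}.
Set Implicit Arguments.
Unset Strict Implicit.

Lemma one_sub_expR_lt0 (t : R) : 0 < t -> 1 - expR t < 0.
Proof. by move=> t0; rewrite subr_lt0 expR_gt1. Qed.

Lemma cvg0_of_bound (f : R -> R) (M : R) :
  (forall t : R, 0 < t -> t <= 1 -> `|f t| <= M * t) -> f x @[x --> 0^'+] --> 0.
Proof.
move=> fM; apply/norm_cvg0P; apply: (@squeeze_cvgr _ _ _ _ (cst 0) (fun t => M * t)).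
- near=> t; rewrite normr_ge0 /=; apply: fM => //; near: t; exact: nbhs_right_le.
- exact: cvg_cst.
- rewrite -[X in _ --> X](mulr0 M); apply: cvgMr; apply: cvg_at_right_filter; exact: cvg_id.
Unshelve. all: by end_near. Qed.

Lemma cvg0_of_poly_bound (f : R -> R) (M : R) (n : nat) :
  (forall t : R, 0 < t -> `|f t| <= M * (t * (1 + t) ^+ n)) ->
  f x @[x --> 0^'+] --> 0.
Proof.
move=> fn; apply: (@cvg0_of_bound _ (M * 2 ^+ n)) => t t0 t1.
have t0' := ltW t0.
have M0 : 0 <= M.
  have := le_trans (normr_ge0 _) (fn _ t0).
  by rewrite pmulr_lge0 // mulr_gt0 ?exprn_gt0 ?addr_gt0.
apply: le_trans (fn _ t0) _; rewrite -mulrA ler_wpM2l // mulrC ler_pM2r //.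
by apply: lerXn2r; rewrite ?nnegrE ?addr_ge0 //; lra.
Qed.

(** The chain rule gives the derivative in t. The bound (1 + t)^n on it integrates to t (1 + t)^n,
    whose own derivative is at least (1 + t)^n. *)
Lemma int0_expR (g : R -> R) (n : nat) :
  (forall z : R, z < 0 -> {for z, continuous g}) ->
  (forall t : R, 0 < t -> `|expR t * g (1 - expR t)| <= (1 + t) ^+ n) ->
  [/\ forall z : R, z < 0 -> {for z, continuous (int0 g)},
      forall t : R, 0 < t -> is_derive t 1 (fun t => int0 g (1 - expR t))
         (- (expR t * g (1 - expR t))) &
      forall t : R, 0 < t -> `|int0 g (1 - expR t)| <= t * (1 + t) ^+ n].
Proof.
move=> gc gb.
have gT (z x : R) : z < 0 -> z <= x -> x < 0 -> `|g x| <= (1 + ln (1 - z)) ^+ n.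
  move=> z0 zx x0.
  have t0 : 0 < ln (1 - x) by rewrite ln_gt0 // ltrDl oppr_gt0.
  have ex : expR (ln (1 - x)) = 1 - x by rewrite lnK // posrE subr_gt0 (lt_trans x0).
  have := gb _ t0; rewrite ex opprB addrCA subrr addr0 => h.
  have h1 : `|g x| <= (1 + ln (1 - x)) ^+ n.
    apply: le_trans h; rewrite normrM ler_peMl // ger0_norm ?subr_ge0 ?(le_trans (ltW x0)) //.
    by rewrite lerDl oppr_ge0 ltW.
  have ln_ge (y : R) : y < 0 -> 0 <= 1 + ln (1 - y).
    by move=> y0; rewrite addr_ge0 // ln_ge0 // lerDl oppr_ge0 ltW.
  apply: le_trans h1 _; apply: lerXn2r; rewrite ?nnegrE ?ln_ge //.
  by rewrite lerD2l ler_ln ?posrE ?subr_gt0 ?(lt_trans _ (@ltr01 R)) // lerD2l lerN2.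
have gd (z : R) : z < 0 -> is_derive z 1 (int0 g) (g z).
  move=> z0; apply: is_derive_int0 => // y y0.
  by exists ((1 + ln (1 - y)) ^+ n) => x yx x0; exact: gT.
have dH (t : R) : 0 < t -> is_derive t 1 (fun t => int0 g (1 - expR t))
         (- (expR t * g (1 - expR t))).
  move=> t0; have dg := gd _ (one_sub_expR_lt0 t0).
  have de : is_derive t 1 (fun t : R => 1 - expR t) (- expR t).
    by rewrite -[- expR t]sub0r; apply: is_deriveB.
  have := @is_derive1_comp _ (int0 g) (fun t : R => 1 - expR t) _ _ _ dg de.
  by rewrite mulrC mulNr.
have lim0 : (fun t => int0 g (1 - expR t)) x @[x --> 0^'+] --> 0.
  apply: (@cvg0_of_bound _ ((1 + 1) ^+ n * expR 1)) => t t0 t1.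
  have z0 := one_sub_expR_lt0 t0.
  have h : `|int0 g (1 - expR t)| <= (1 + t) ^+ n * - (1 - expR t).
    apply: int0_bound => // x zx x0; apply: le_trans (gT _ _ z0 zx x0) _.
    by rewrite opprB addrCA subrr addr0 expRK.
  apply: le_trans h _; rewrite -mulrA.
  have t0' := ltW t0.
  apply: ler_pM; rewrite ?exprn_ge0 ?addr_ge0 ?oppr_ge0 ?(ltW z0) //.
    by apply: lerXn2r; rewrite ?nnegrE ?addr_ge0 ?lerD2l.
  (* This yields e^t - 1 <= t e^t, which is at most e t for t <= 1. *)
  have : (1 - t) * expR t <= 1.
    rewrite -[X in _ <= X](expRxMexpNx_1 t) mulrC ler_pM2l ?expR_gt0 //.
    exact: expR_ge1Dx.
  have : expR t <= expR 1 by rewrite ler_expR.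
  nra.
split=> // [z z0|t t0].
  have [d _] := gd z z0; exact/differentiable_continuous/derivable1_diffP.
pose B (t : R) := t * (1 + t) ^+ n.
pose dB (t : R) := (1 + t) ^+ n + t * (n%:R * (1 + t) ^+ n.-1).
have Bd (s : R) : 0 < s -> is_derive s 1 B (dB s).
  move=> s0; rewrite /B /dB; have d1 : is_derive s 1 (fun t : R => 1 + t) 1.
    by have := is_deriveD (is_derive_cst (1 : R) s 1) (is_derive_id s 1); rewrite add0r.
  have := is_derive_mul (is_derive_id s 1) (is_derive_exp n d1).
  by rewrite mulr1 mul1r.
have B0 : B x @[x --> 0^'+] --> 0.
  apply: (@cvg0_of_poly_bound _ 1 n) => s s0; rewrite mul1r.
  by rewrite ger0_norm // mulr_ge0 ?exprn_ge0 ?addr_ge0 // ltW.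
have dBge (s : R) : 0 < s -> (1 + s) ^+ n <= dB s.
  by move=> s0; rewrite lerDl !mulr_ge0 ?exprn_ge0 ?addr_ge0 // ltW.
(* The sum and the difference of [B] and the integral vanish at 0 and have nonnegative
   derivatives. *)
rewrite ler_norml; apply/andP; split; rewrite -subr_ge0 ?opprK.
- apply: (@nonneg_of_deriv _ ((fun t => int0 g (1 - expR t)) + B)
    (fun t => - (expR t * g (1 - expR t)) + dB t)) => //.
  + by move=> s s0; apply: is_deriveD; [exact: dH|exact: Bd].
  + move=> s s0; rewrite addrC subr_ge0; apply: le_trans (dBge _ s0).
    by apply: le_trans (gb _ s0); exact: ler_norm.
  + by rewrite -[X in _ --> X](addr0 0); apply: cvgD.
- apply: (@nonneg_of_deriv _ (B - (fun t => int0 g (1 - expR t)))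
    (fun t => dB t - - (expR t * g (1 - expR t)))) => //.
  + by move=> s s0; apply: is_deriveB; [exact: Bd|exact: dH].
  + move=> s s0; rewrite subr_ge0; apply: le_trans (dBge _ s0).
    by apply: le_trans (gb _ s0); rewrite -normrN ler_norm.
  + by rewrite -[X in _ --> X](subr0 0); apply: cvgB.
Qed.

End Int0ExpR.

(** * Polylogarithms at 1 - e^t *)

Section Polylog.
Context {R : realType}.
Set Implicit Arguments.
Unset Strict Implicit.

(** A class preserved by both kinds of integration. The factor t records the vanishing at z = 0,
    which keeps [f z / z] bounded there; the growth is polynomial in t = ln (1 - z). *)
Definition tame (f : R -> R) :=
  (forall z : R, z < 0 -> {for z, continuous f}) /\
  exists n : nat, forall t : R, 0 < t -> `|f (1 - expR t)| <= t * (1 + t) ^+ n.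

(** Under the substitution e^t / (1 - z) = 1, so the integrand becomes f itself. The assumed bound
    has no factor t, so as to cover the constant 1 of the empty index. *)
Lemma tame_int0_one_sub (f : R -> R) :
  (forall z : R, z < 0 -> {for z, continuous f}) ->
  (exists n : nat, forall t : R, 0 < t -> `|f (1 - expR t)| <= (1 + t) ^+ n) ->
  tame (int0 (fun z => f z / (1 - z))) /\
  forall t : R, 0 < t ->
    is_derive t 1 (fun t => int0 (fun z => f z / (1 - z)) (1 - expR t)) (- f (1 - expR t)).
Proof.
move=> fc [n fn].
have e (t : R) : expR t * (f (1 - expR t) / (1 - (1 - expR t))) = f (1 - expR t).
  by rewrite subKr mulrC divfK // gt_eqF // expR_gt0.
have [z z0|t t0|gc gd gb] := @int0_expR R (fun z => f z / (1 - z)) n.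
- apply: continuousM; first exact: fc.
  apply: continuousV; first by rewrite gt_eqF // subr_gt0 (lt_trans z0).
  by apply: continuousB; [exact: cvg_cst|exact: cvg_id].
- by rewrite e fn.
- split; first by split=> //; exists n.
  by move=> t /gd; rewrite e.
Qed.

Lemma tame_int0_div (f : R -> R) : tame f ->
  tame (int0 (fun z => f z / z)) /\
  forall t : R, 0 < t ->
    is_derive t 1 (fun t => int0 (fun z => f z / z) (1 - expR t))
      (expR t / (expR t - 1) * f (1 - expR t)).
Proof.
move=> [fc [n fn]].
have e (t : R) : expR t * (f (1 - expR t) / (1 - expR t)) =
    - (expR t / (expR t - 1) * f (1 - expR t)).
  by rewrite -[X in _ / X]opprB invrN; ring.
have [z z0|t t0|gc gd gb] := @int0_expR R (fun z => f z / z) n.+1.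
- apply: continuousM; first exact: fc.
  by apply: continuousV; [rewrite lt_eqF|exact: cvg_id].
- have e1 : 0 < expR t - 1 by rewrite subr_gt0 expR_gt1.
  rewrite e normrN normrM ger0_norm ?divr_ge0 ?expR_ge0 ?(ltW e1) //.
  rewrite mulrAC ler_pdivrMr //.
  apply: le_trans (_ : expR t * (t * (1 + t) ^+ n) <= _).
    by rewrite ler_pM2l ?expR_gt0 // fn.
  rewrite exprS -subr_ge0.
  (* The estimate t e^t / (e^t - 1) <= 1 + t amounts to 1 + t <= e^t; it costs one more power of 1 +
     t. *)
  have -> : (1 + t) * (1 + t) ^+ n * (expR t - 1) - expR t * (t * (1 + t) ^+ n) =
      (1 + t) ^+ n * (expR t - (1 + t)) by ring.
  by rewrite mulr_ge0 ?subr_ge0 ?expR_ge1Dx // exprn_ge0 // addr_ge0 // ltW.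
- split; first by split=> //; exists n.+1.
  by move=> t /gd; rewrite e opprK.
Qed.

Lemma tame_polylog_rev k ks : tame (polylog_rev (k :: ks)).
Proof.
have itert (f : R -> R) m : tame f -> tame (iter m (fun f : R -> R => int0 (fun t => f t / t)) f).
  by move=> tf; elim: m => //= m /tame_int0_div [].
elim: ks k => [|k' ks IH] k; apply: itert.
  apply: (tame_int0_one_sub _ _).1; first by move=> z _; exact: cvg_cst.
  by exists 0%N => t t0; rewrite normr1 expr0.
have [c [n h]] := IH k'.
apply: (tame_int0_one_sub _ _).1 => //; exists n.+1 => t t0.
apply: le_trans (h _ t0) _; rewrite exprS ler_wpM2r ?exprn_ge0 ?addr_ge0 ?lerDr // ltW //.
Qed.

(** The function L of the introduction, with k_r at the head of the list. *)
Definition polylog_expR (ks : seq nat) (t : R) : R := polylog_rev ks (1 - expR t).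

Lemma is_derive_polylog_expR1 ks (t : R) : 0 < t ->
  is_derive t 1 (polylog_expR (1%N :: ks)) (- polylog_expR ks t).
Proof.
move: t; apply: (tame_int0_one_sub _ _).2; case: ks => [|k ks].
- by move=> z _; exact: cvg_cst.
- by have [] := tame_polylog_rev k ks.
- by exists 0%N => t t0; rewrite normr1 expr0.
have [c [n h]] := tame_polylog_rev k ks.
exists n.+1 => t t0.
by apply: le_trans (h _ t0) _; rewrite exprS ler_wpM2r ?exprn_ge0 ?addr_ge0 ?lerDr // ltW.
Qed.

Lemma is_derive_polylog_exprS k ks (t : R) : (0 < k)%N -> 0 < t ->
  is_derive t 1 (polylog_expR (k.+1 :: ks))
    (expR t / (expR t - 1) * polylog_expR (k :: ks) t).
Proof.
case: k => // k _; move: t.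
exact: (tame_int0_div (tame_polylog_rev k.+1 ks)).2.
Qed.

(** The analogue of [tame] in the variable t; the constant M makes it stable under linear
    combinations. It gives both the limit 0 at 0 and integrability against the kernel of eta. *)
Definition poly_bounded (f : R -> R) :=
  (forall t : R, 0 < t -> {for t, continuous f}) /\
  exists M n, forall t : R, 0 < t -> `|f t| <= M * (t * (1 + t) ^+ n).

Lemma poly_bounded_cvg0 f : poly_bounded f -> f x @[x --> 0^'+] --> 0.
Proof. by move=> [_ [M [n]]]; exact: cvg0_of_poly_bound. Qed.

Lemma poly_bounded_polylog k ks : poly_bounded (polylog_expR (k :: ks)).
Proof.
have [c [n h]] := tame_polylog_rev k ks; split; last first.
  by exists 1, n => t t0; rewrite mul1r; exact: h.
move=> t t0; apply: (@continuous_comp _ _ _ (fun t : R => 1 - expR t) (polylog_rev (k :: ks))).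
  by apply: continuousB; [exact: cvg_cst|exact: continuous_expR].
exact/c/one_sub_expR_lt0.
Qed.

Lemma poly_bounded0 : poly_bounded (fun=> 0).
Proof.
split; first by move=> t _; exact: cvg_cst.
by exists 0, 0%N => t _; rewrite normr0 mul0r.
Qed.

Lemma poly_boundedD f g : poly_bounded f -> poly_bounded g ->
  poly_bounded (fun t => f t + g t).
Proof.
move=> [fc [M [n fM]]] [gc [N [m gN]]]; split.
  by move=> t t0; apply: continuousD; [exact: fc|exact: gc].
exists (M + N), (n + m)%N => t t0.
apply: le_trans (ler_normD _ _) _; rewrite mulrDl.
(* The constant is nonnegative, since it bounds an absolute value, so both exponents can be raised
   to n + m. *)
have le_pow (a : R) (h : R -> R) i j : `|h t| <= a * (t * (1 + t) ^+ i) ->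
    a * (t * (1 + t) ^+ i) <= a * (t * (1 + t) ^+ (i + j)).
  move=> ha; have := le_trans (normr_ge0 _) ha.
  rewrite pmulr_lge0 ?mulr_gt0 ?exprn_gt0 ?addr_gt0 // => a0.
  by rewrite ler_wpM2l // ler_pM2l // ler_weXn2l ?leq_addr // lerDl ltW.
apply: lerD; first exact: le_trans (fM _ t0) (le_pow _ f _ _ (fM _ t0)).
by rewrite addnC; exact: le_trans (gN _ t0) (le_pow _ g _ _ (gN _ t0)).
Qed.

Lemma poly_bounded_sum (I : eqType) (s : seq I) (F : I -> R -> R) :
  (forall i, i \in s -> poly_bounded (F i)) -> poly_bounded (fun t => \sum_(i <- s) F i t).
Proof.
elim: s => [_|i s IH h].
  under eq_fun do rewrite big_nil; exact: poly_bounded0.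
under eq_fun do rewrite big_cons; apply: poly_boundedD.
  by apply: h; rewrite mem_head.
by apply: IH => j js; apply: h; rewrite inE js orbT.
Qed.

(** Here t^n is absorbed by (1 + t)^n. With c = 1/n! the product is [divpow n t * f t] unfolded. *)
Lemma poly_boundedMX (c : R) n f : poly_bounded f ->
  poly_bounded (fun t => t ^+ n * c * f t).
Proof.
move=> [fc [M [m fM]]]; split.
  move=> t t0; apply: continuousM; last exact: fc.
  by apply: continuousM; [exact: exprn_continuous|exact: cvg_cst].
exists (`|c| * M), (n + m)%N => t t0; rewrite !normrM normrX [`|t|]ger0_norm ?(ltW t0) //.
rewrite exprD [t ^+ n * _]mulrC -!mulrA ler_wpM2l //.
apply: le_trans (_ : t ^+ n * (M * (t * (1 + t) ^+ m)) <= _).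
  by rewrite ler_pM2l ?exprn_gt0 // fM.
have := le_trans (normr_ge0 _) (fM _ t0).
rewrite pmulr_lge0 ?mulr_gt0 ?exprn_gt0 ?addr_gt0 // => M0.
rewrite mulrCA ler_wpM2l // mulrCA ler_pM2l // ler_pM2r ?exprn_gt0 ?addr_gt0 //.
by apply: lerXn2r; rewrite ?nnegrE ?addr_ge0 ?lerDr // ltW.
Qed.

End Polylog.

(** * The pointwise identities *)

Section Pointwise.
Context {R : realType}.
Set Implicit Arguments.
Unset Strict Implicit.

Implicit Types (X : nat -> R -> R) (t : R).

Definition divpow n t : R := t ^+ n / n`!%:R.

(** Up to sign, the right-hand side of both pointwise identities, with indices lowered by one: [X i]
    is the term j = i + 1, and [r] is one less than the r of the theorem. *)
Definition dpconv r X t : R := \sum_(i < r.+1) divpow (r - i) t * X i t.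

Definition prev_dpconv r X t : R := if r is r'.+1 then dpconv r' X t else 0.

Lemma dpconv_shift r X t :
  dpconv r X t = divpow r t * X 0%N t + prev_dpconv r (fun i => X i.+1) t.
Proof.
rewrite /dpconv big_ord_recl subn0; congr (_ + _).
by case: r => [|r]; rewrite ?big_ord0.
Qed.

Lemma is_derive_bigsum (I : eqType) (s : seq I) (F : I -> R -> R) (dF : I -> R) t :
  (forall i, i \in s -> is_derive t 1 (F i) (dF i)) ->
  is_derive t 1 (fun t => \sum_(i <- s) F i t) (\sum_(i <- s) dF i).
Proof.
elim: s => [_|i s IH h].
  by under eq_fun do rewrite big_nil; rewrite big_nil; exact: is_derive_cst.
under eq_fun do rewrite big_cons; rewrite big_cons; apply: is_deriveD.
  by apply: h; rewrite mem_head.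
by apply: IH => j js; apply: h; rewrite inE js orbT.
Qed.

Lemma is_derive_divpowS n t : is_derive t 1 (divpow n.+1) (divpow n t).
Proof.
have := is_derive_mul (is_derive_exp n.+1 (is_derive_id t 1))
  (is_derive_cst (n.+1`!%:R^-1 : R) t 1).
rewrite mulr1 mulr0 addr0 /divpow factS natrM invfM mulrACA.
by rewrite mulfV ?pnatr_eq0 // mul1r.
Qed.

Lemma is_derive_divpow0 t : is_derive t 1 (divpow 0) 0.
Proof.
by rewrite /divpow; under eq_fun do rewrite expr0; exact: is_derive_cst.
Qed.

Lemma continuous_divpow n : continuous (divpow n).
Proof.
by move=> t; apply: (@continuousM _ _ (fun t => t ^+ n) (cst _));
  [exact: exprn_continuous|exact: cvg_cst].
Qed.

(** Differentiating a divided power lowers its exponent by one, and kills the last term, of exponent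
    0; this leaves [prev_dpconv r X]. *)
Lemma is_derive_dpconv r X (dX : nat -> R) t :
  (forall i, is_derive t 1 (X i) (dX i)) ->
  is_derive t 1 (dpconv r X)
    (prev_dpconv r X t + \sum_(i < r.+1) divpow (r - i) t * dX i).
Proof.
move=> h.
pose dp n := if n is n'.+1 then divpow n' t else 0.
have dpE n : is_derive t 1 (divpow n) (dp n).
  by case: n => [|n]; [exact: is_derive_divpow0|exact: is_derive_divpowS].
apply: is_derive_eq.
  exact: (@is_derive_bigsum _ _ (fun i : 'I_r.+1 => fun t => divpow (r - i) t * X i t) _ _
    (fun i _ => is_derive_mul (dpE (r - i)%N) (h i))).
rewrite big_split; congr (_ + _).
case: r => [|r]; first by rewrite big_ord1 mul0r.
rewrite big_ord_recr /= subnn mul0r addr0.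
by apply: eq_bigr => i _; rewrite subSn // -ltnS.
Qed.

Lemma is_deriveZl (c df : R) (f : R -> R) t : is_derive t 1 f df ->
  is_derive t 1 (fun t => c * f t) (c * df).
Proof.
by move=> d; have := is_derive_mul (is_derive_cst c t 1) d; rewrite mul0r add0r.
Qed.

Lemma poly_bounded_dpconv r X : (forall i, poly_bounded (X i)) -> poly_bounded (dpconv r X).
Proof. by move=> h; apply: poly_bounded_sum => i _; exact: poly_boundedMX. Qed.

Lemma poly_boundedZ (c : R) f : poly_bounded f -> poly_bounded (fun t => c * f t).
Proof.
move=> /(@poly_boundedMX _ c 0).
by under eq_fun do rewrite expr0 mul1r.
Qed.

Lemma poly_bounded_divpow n : poly_bounded (divpow n.+1).
Proof.
have p1 : poly_bounded (fun t : R => t).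
  split; first by move=> t _; exact: cvg_id.
  by exists 1, 0%N => t t0; rewrite expr0 mulr1 mul1r ger0_norm // ltW.
have -> : divpow n.+1 = fun t => t ^+ n * (n.+1`!%:R)^-1 * t.
  by apply/funext => t; rewrite /divpow exprSr mulrAC.
exact: poly_boundedMX.
Qed.

(** The classical formula Li_{1,...,1}(z) = (- ln (1 - z))^n / n! at z = 1 - e^t. *)
Lemma polylog_expR_ones n t : 0 < t ->
  polylog_expR (nseq n 1%N) t = (-1) ^+ n * divpow n t.
Proof.
elim: n t => [|n IH] t t0.
  by rewrite /polylog_expR /divpow /= !expr0 fact0 invr1 !mulr1.
apply: (@eq_of_deriv _ _ (fun t => (-1) ^+ n.+1 * divpow n.+1 t)
  (fun t => (-1) ^+ n.+1 * divpow n t)) t0 => [s s0|s s0||].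
- by rewrite exprS mulN1r mulNr -IH //; exact: is_derive_polylog_expR1.
- exact/is_deriveZl/is_derive_divpowS.
- exact/poly_bounded_cvg0/poly_bounded_polylog.
- exact/poly_bounded_cvg0/poly_boundedZ/poly_bounded_divpow.
Qed.

(* L_{{1}_r, m+1} *)
Definition height1 m r : R -> R := polylog_expR (m.+1 :: nseq r 1%N).

(* The sum of L_{k_1,...,k_j} over k_1 + ... + k_j = m + j, i.e. k = m + 1. *)
Definition sum_weight m j t : R := \sum_(ks <- rcomps (m + j) j) polylog_expR ks t.

Lemma rcomps_diag n : rcomps n n = [:: nseq n 1%N].
Proof. by elim: n => //= n ->; rewrite rcomps_nil. Qed.

Lemma sum_weight0 j t : sum_weight 0 j t = polylog_expR (nseq j 1%N) t.
Proof. by rewrite /sum_weight rcomps_diag big_seq1. Qed.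

Lemma sum_weightS0 m t : sum_weight m.+1 0 t = 0.
Proof. by rewrite /sum_weight addn0 big_nil. Qed.

Lemma mem_rcompsS n j ks : ks \in rcomps n j.+1 ->
  exists k ks', ks = k.+1 :: ks'.
Proof.
by rewrite mem_rcomps; case: ks => [//|[|k] ks]; rewrite /= ?andbF // => _; exists k, ks.
Qed.

Lemma poly_bounded_sum_weight m j : poly_bounded (sum_weight m j.+1).
Proof.
apply: poly_bounded_sum => ks /mem_rcompsS [k [ks' ->]]; exact: poly_bounded_polylog.
Qed.

(** The recursion of [rcomps] matches the two derivation rules: a last part 1 is removed, which
    keeps m, and a larger last part is lowered, which lowers m. For m = 0 all parts are 1 and only
    the first case occurs. *)
Lemma is_derive_sum_weight m j t : 0 < t ->
  is_derive t 1 (sum_weight m j.+1)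
    ((if m is m'.+1 then expR t / (expR t - 1) * sum_weight m' j.+1 t else 0)
     - sum_weight m j t).
Proof.
move=> t0; rewrite addrC /sum_weight addnS /=.
under eq_fun do rewrite big_cat !big_map.
apply: is_deriveD.
  rewrite -sumrN; apply: is_derive_bigsum => ks _; exact: is_derive_polylog_expR1.
case: m => [|m]; first by rewrite rcomps_nil; under eq_fun do rewrite big_nil; exact: is_derive_cst.
rewrite addSnnS mulr_sumr.
apply: is_derive_bigsum => ks /mem_rcompsS [k [ks' ->]].
exact: is_derive_polylog_exprS.
Qed.

(** Induction on m by comparing derivatives. The terms from the divided powers cancel those from
    removing a last part 1, except for a boundary term with the empty index, equal to t^r/r! if m =
    0 and to 0 otherwise. *)
Lemma height1_dpconv m r t : 0 < t ->
  height1 m r t = (-1) ^+ r * dpconv r (fun i => sum_weight m i.+1) t.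
Proof.
elim: m t => [|m IH] t t0.
- apply: (@eq_of_deriv _ _ (fun t => (-1) ^+ r * dpconv r (fun i => sum_weight 0 i.+1) t)
    (fun t => - ((-1) ^+ r * divpow r t))) t0 => [s s0|s s0||].
  + by rewrite -polylog_expR_ones //; exact: is_derive_polylog_expR1.
  + apply: is_derive_eq.
      apply/is_deriveZl/is_derive_dpconv => i; exact: is_derive_sum_weight.
    (* Isolating the term i = 0 exposes the telescoping. *)
    have /= := dpconv_shift r (sum_weight 0) s; rewrite /dpconv sum_weight0 mulr1 => e.
    under eq_bigr do rewrite sub0r mulrN; rewrite sumrN e; ring.
  + exact/poly_bounded_cvg0/poly_bounded_polylog.
  + apply/poly_bounded_cvg0/poly_boundedZ/poly_bounded_dpconv => i.
    exact: poly_bounded_sum_weight.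
- apply: (@eq_of_deriv _ _ (fun t => (-1) ^+ r * dpconv r (fun i => sum_weight m.+1 i.+1) t)
    (fun t => expR t / (expR t - 1) * height1 m r t)) t0 => [s s0|s s0||].
  + exact: is_derive_polylog_exprS.
  + apply: is_derive_eq.
      apply/is_deriveZl/is_derive_dpconv => i; exact: is_derive_sum_weight.
    have /= := dpconv_shift r (sum_weight m.+1) s; rewrite /dpconv sum_weightS0 mulr0 add0r => e.
    under eq_bigr do rewrite mulrBr mulrCA.
    rewrite sumrB e -mulr_sumr IH // /dpconv; ring.
  + exact/poly_bounded_cvg0/poly_bounded_polylog.
  + apply/poly_bounded_cvg0/poly_boundedZ/poly_bounded_dpconv => i.
    exact: poly_bounded_sum_weight.
Qed.

(** For m = 0 this is [height1_dpconv], since both families consist of the L with all entries 1.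
    Otherwise the derivatives agree by induction on m, for the terms with factor e^t / (e^t - 1),
    and on r, for the others. *)
Lemma sum_weight_dpconv m r t : 0 < t ->
  sum_weight m r.+1 t = (-1) ^+ r * dpconv r (height1 m) t.
Proof.
elim: m r t => [|m IHm] r t t0.
  rewrite sum_weight0 -/(height1 0 r t) height1_dpconv // /dpconv; congr (_ * _).
  by apply: eq_bigr => i _; rewrite sum_weight0.
(* The premise is the identity for n - 1, written with [prev_dpconv] so that n = 0 is covered, where
   it reads 0 = 0. *)
have step n : (forall s : R, 0 < s ->
    (-1) ^+ n * prev_dpconv n (height1 m.+1) s = - sum_weight m.+1 n s) ->
  forall s : R, 0 < s -> sum_weight m.+1 n.+1 s = (-1) ^+ n * dpconv n (height1 m.+1) s.
  move=> prev; apply: (@eq_of_deriv _ _ _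
    (fun s => expR s / (expR s - 1) * sum_weight m n.+1 s - sum_weight m.+1 n s)).
  - by move=> s s0; exact: is_derive_sum_weight.
  - move=> s s0; apply: is_derive_eq.
      apply/is_deriveZl/is_derive_dpconv => i; exact: is_derive_polylog_exprS.
    under eq_bigr do rewrite mulrCA.
    by rewrite mulrDr prev // -mulr_sumr IHm // addrC mulrCA.
  - exact/poly_bounded_cvg0/poly_bounded_sum_weight.
  - apply/poly_bounded_cvg0/poly_boundedZ/poly_bounded_dpconv => i.
    exact: poly_bounded_polylog.
elim: r t t0 => [|r IHr]; apply: step => s s0.
  by rewrite mulr0 sum_weightS0 oppr0.
by rewrite IHr // exprS mulN1r mulNr.
Qed.

End Pointwise.

(** * Integration *)

Section Integration.
Context {R : realType}.
Set Implicit Arguments.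
Unset Strict Implicit.
Notation mu := (@lebesgue_measure R).

Implicit Types (X : nat -> R -> R) (t : R).

(** From (a + t)^(n+1) / (n+1)! <= e^(a+t), the function is at most (n + 1) e^a / (a + t). *)
Lemma divpow_expR_cvg0 (a : R) n : 0 <= a ->
  (expR (- t) * divpow n (a + t)) @[t --> +oo] --> 0.
Proof.
move=> a0; apply/cvgrPdist_le => e e0; near=> t.
have t0 : 0 < t by near: t; apply: nbhs_pinfty_gt; exact: num_real.
have at0 : 0 < a + t by rewrite ltr_wpDl.
rewrite sub0r normrN ger0_norm ?mulr_ge0 ?divr_ge0 ?exprn_ge0 ?expR_ge0 ?(ltW at0) //.
have h : (a + t) * divpow n (a + t) <= n.+1%:R * expR (a + t).
  have -> : (a + t) * divpow n (a + t) = n.+1%:R * ((a + t) ^+ n.+1 / n.+1`!%:R).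
    by rewrite /divpow factS natrM invfM exprS [RHS]mulrCA mulVKf ?pnatr_eq0 // mulrA.
  rewrite ler_pM2l ?ltr0n //; apply: le_trans (expR_ge1Dxn n (ltW at0)).
  by rewrite lerDr.
have h2 : n.+1%:R * expR a <= e * t.
  rewrite -ler_pdivrMl //; near: t; apply: nbhs_pinfty_ge; exact: num_real.
rewrite -(ler_pM2l at0) mulrCA.
apply: le_trans (_ : expR (- t) * (n.+1%:R * expR (a + t)) <= _).
  by rewrite ler_pM2l ?expR_gt0.
rewrite expRD !mulrA [_ * expR t]mulrC !mulrA expRxMexpNx_1 mul1r.
by apply: le_trans h2 _; rewrite mulrC ler_pM2r // lerDr.
Unshelve. all: by end_near. Qed.

Lemma continuous_expR_divpow (a : R) n : continuous (fun t => expR (- t) * divpow n (a + t)).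
Proof.
move=> t; apply: (@continuousM _ _ (fun t => expR (- t)) (fun t => divpow n (a + t))).
  apply: (@continuous_comp _ _ _ (fun t : R => - t) expR); last exact: continuous_expR.
  by apply: continuousN; exact: cvg_id.
apply: (@continuous_comp _ _ _ (fun t : R => a + t) (divpow n)); last exact: continuous_divpow.
by apply: continuousD; [exact: cvg_cst|exact: cvg_id].
Qed.

(** The derivative of the antiderivative [F] telescopes. The case a = 0 computes Gamma, and a = 1
    provides the dominating function for the eta integrals. *)
Lemma integral_divpow_expR (a : R) n : 0 <= a ->
  (\int[mu]_(t in `[0%R, +oo[) (expR (- t) * divpow n (a + t))%:E =
   (\sum_(i < n.+1) divpow i a)%:E)%E.
Proof.
move=> a0.
pose F t := - \sum_(i < n.+1) expR (- t) * divpow i (a + t).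
have dat (t : R) : is_derive t 1 (fun t => a + t) 1.
  by have := is_deriveD (is_derive_cst a t 1) (is_derive_id t 1); rewrite add0r.
have dexp (t : R) : is_derive t 1 (fun t => expR (- t)) (- expR (- t)).
  have := @is_derive1_comp _ expR (fun t => - t) t _ _ (is_derive_expR _)
    (is_deriveN (is_derive_id t 1)).
  by rewrite mulrN1.
have dpE i (t : R) : is_derive t 1 (divpow i) (if i is i'.+1 then divpow i' t else 0).
  by case: i => [|i]; [exact: is_derive_divpow0|exact: is_derive_divpowS].
have dterm i (t : R) : is_derive t 1 (fun t => expR (- t) * divpow i (a + t))
   (- expR (- t) * divpow i (a + t) +
    expR (- t) * ((if i is i'.+1 then divpow i' (a + t) else 0) * 1)).
  have dcomp := @is_derive1_comp _ (divpow i) (fun t => a + t) t _ _ (dpE i _) (dat t).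
  exact: (is_derive_mul (dexp t) dcomp).
have dF (t : R) : is_derive t 1 F (expR (- t) * divpow n (a + t)).
  have D : is_derive t 1 F _ := is_deriveN (@is_derive_bigsum _ _ _
     (fun (i : 'I_n.+1) t => expR (- t) * divpow i (a + t)) _ t (fun i _ => dterm i t)).
  apply: (is_derive_eq D); rewrite big_split /=.
  rewrite [X in _ + X]big_ord_recl mul0r mulr0 add0r big_ord_recr /=.
  under eq_bigr do rewrite mulNr; rewrite sumrN.
  under [X in _ + _ + X]eq_bigr do rewrite mulr1; ring.
rewrite (@ge0_continuous_FTC2y _ _ F 0 0).
- rewrite /F oppr0 expR0 addr0 sub0e -EFinN opprK; congr EFin.
  by apply: eq_bigr => i _; rewrite mul1r.
- by move=> x x0; rewrite mulr_ge0 ?expR_ge0 ?divr_ge0 ?exprn_ge0 ?addr_ge0.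
- exact/continuous_subspaceT/continuous_expR_divpow.
- rewrite -[X in _ --> X]oppr0; apply: cvgN.
  rewrite -[X in _ --> X](_ : \sum_(i < n.+1) 0 = 0 :> R); last by rewrite big1.
  by apply: cvg_big => [|i _]; [exact: add_continuous|exact: divpow_expR_cvg0].
- by move=> x _; have [] := dF x.
- apply: cvg_at_right_filter; have [d _] := dF 0; exact/differentiable_continuous/derivable1_diffP.
- by move=> x _; rewrite derive1E; have [_ ->] := dF x.
Qed.

Lemma integrable_divpow_expR (a : R) n : 0 <= a ->
  mu.-integrable `]0, +oo[ (EFin \o (fun t => expR (- t) * divpow n (a + t))).
Proof.
move=> a0.
have : mu.-integrable `[0, +oo[ (EFin \o (fun t => expR (- t) * divpow n (a + t))).
  apply/integrableP; split.
    apply/measurable_EFinP; apply: subspace_continuous_measurable_fun => //.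
    exact/continuous_subspaceT/continuous_expR_divpow.
  rewrite [ltLHS](_ : _ = (\sum_(i < n.+1) divpow i a)%:E) ?ltry //.
  rewrite -integral_divpow_expR //; apply: eq_integral => t.
  rewrite inE /= in_itv /= andbT => t0.
  by rewrite ger0_norm // mulr_ge0 ?expR_ge0 ?divr_ge0 ?exprn_ge0 ?addr_ge0.
by apply: integrableS => //; apply: subset_itvr; rewrite bnd_simp.
Qed.

Lemma GammaE n : Gamma (n.+1%:R : R) = n`!%:R.
Proof.
rewrite /Gamma.
have -> : \int[mu]_(t in `]0, +oo[) (t `^ (n.+1%:R - 1) * expR (- t)) =
    \int[mu]_(t in `]0, +oo[) (expR (- t) * divpow n (0 + t) * n`!%:R).
  apply: eq_Rintegral => t; rewrite inE /= in_itv /= andbT => t0.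
  rewrite -natr1 addrK powR_mulrn ?(ltW t0) // add0r mulrC -mulrA /divpow divfK //.
have i0 := integral_divpow_expR n (lexx 0).
have h1 : \sum_(i < n.+1) divpow i 0 = 1 :> R.
  rewrite big_ord_recl big1 => [|i _]; first by rewrite /divpow expr0 fact0 divr1 addr0.
  by rewrite /divpow expr0n mul0r.
have gi : mu.-integrable `]0, +oo[ (EFin \o (fun t => expR (- t) * divpow n (0 + t))).
  exact: integrable_divpow_expR.
by rewrite RintegralZr // Rintegral_itv_obnd_cbnd // /Rintegral i0 h1 mul1r.
Qed.

(** For s = n + 1 this is t^(s-1) / Gamma(s) / (1 - e^t): the Gamma factor of eta is built in. *)
Definition eta_kernel n t : R := divpow n t / (1 - expR t).

Lemma integrable_eta_kernel n (f : R -> R) : poly_bounded f ->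
  mu.-integrable `]0, +oo[ (EFin \o (fun t => eta_kernel n t * f t)).
Proof.
move=> [fc [M [m fM]]].
(* The exponent n comes from t^n, m from the bound on f, and 1 from t / (e^t - 1) <= (1 + t) e^(-t),
   which follows from 1 + t <= e^t. *)
pose N := (n + m.+1)%N.
have gi : mu.-integrable `]0, +oo[
    (fun t => (M * N`!%:R)%:E * (expR (- t) * divpow N (1 + t))%:E)%E.
  by apply: integrableZl => //; exact: integrable_divpow_expR.
apply: le_integrable gi => //.
- apply/measurable_EFinP; apply: open_continuous_measurable_fun => // t.
  rewrite inE /= in_itv /= andbT => t0.
  apply: continuousM; last exact: fc.
  apply: continuousM; first exact: continuous_divpow.
  apply: continuousV; first by rewrite lt_eqF // one_sub_expR_lt0.
  by apply: continuousB; [exact: cvg_cst|exact: continuous_expR].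
move=> t /=; rewrite in_itv /= andbT => t0.
have t0' := ltW t0.
have E1 : 0 < expR t - 1 by rewrite subr_gt0 expR_gt1.
have M0 : 0 <= M.
  have := le_trans (normr_ge0 _) (fM _ t0).
  by rewrite pmulr_lge0 // mulr_gt0 ?exprn_gt0 ?addr_gt0.
rewrite lee_fin /eta_kernel -[1 - expR t]opprB invrN mulrN mulNr normrN.
rewrite [leRHS]ger0_norm; last first.
  by rewrite !mulr_ge0 ?expR_ge0 ?invr_ge0 ?exprn_ge0 ?addr_ge0.
have -> : M * N`!%:R * (expR (- t) * divpow N (1 + t)) = M * (expR (- t) * (1 + t) ^+ N).
  by rewrite /divpow; field; rewrite pnatr_eq0 -lt0n fact_gt0.
rewrite normrM normrM normfV [`|divpow n t|]ger0_norm ?divr_ge0 ?exprn_ge0 //.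
rewrite [`|expR t - 1|]ger0_norm ?(ltW E1) //.
rewrite mulrAC ler_pdivrMr //.
apply: le_trans (_ : (1 + t) ^+ n * (M * (t * (1 + t) ^+ m)) <= _).
  apply: ler_pM; rewrite ?divr_ge0 ?exprn_ge0 ?fM //.
  apply: le_trans (_ : t ^+ n <= _).
    by rewrite ler_pdivrMr ?ltr0n ?fact_gt0 // ler_peMr ?exprn_ge0 // ler1n fact_gt0.
  by apply: lerXn2r; rewrite ?nnegrE ?addr_ge0 ?lerDr.
have -> : (1 + t) ^+ n * (M * (t * (1 + t) ^+ m)) = M * (t * (1 + t) ^+ (n + m)).
  by rewrite exprD; ring.
have -> : M * (expR (- t) * (1 + t) ^+ N) * (expR t - 1) =
    M * ((1 + t) * (1 - expR (- t)) * (1 + t) ^+ (n + m)).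
  by rewrite -[X in X - expR (- t)](expRxMexpNx_1 t) /N addnS exprS; ring.
rewrite ler_wpM2l // ler_pM2r ?exprn_gt0 ?addr_gt0 // mulrBr mulr1 -lerBlDr opprK.
have : (1 + t) * expR (- t) <= expR t * expR (- t).
  by rewrite ler_pM2r ?expR_gt0 // expR_ge1Dx.
rewrite expRxMexpNx_1; lra.
Qed.

Definition eta_int n (f : R -> R) : R := \int[mu]_(t in `]0, +oo[) (eta_kernel n t * f t).

Lemma eq_eta_int n (f g : R -> R) : (forall t, 0 < t -> f t = g t) ->
  eta_int n f = eta_int n g.
Proof.
move=> fg; apply: eq_Rintegral => t; rewrite inE /= in_itv /= andbT => t0.
by rewrite fg.
Qed.

Lemma eta_intZ n c f : poly_bounded f ->
  eta_int n (fun t => c * f t) = c * eta_int n f.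
Proof.
move=> pf; rewrite /eta_int -RintegralZl //; last exact: integrable_eta_kernel.
by apply: eq_Rintegral => t _; rewrite mulrCA.
Qed.

Lemma eta_int_sum n (I : eqType) (s : seq I) (F : I -> R -> R) :
  (forall i, i \in s -> poly_bounded (F i)) ->
  eta_int n (fun t => \sum_(i <- s) F i t) = \sum_(i <- s) eta_int n (F i).
Proof.
elim: s => [_|i s IH h].
  rewrite big_nil /eta_int; under eq_Rintegral do rewrite big_nil mulr0.
  by rewrite Rintegral_cst // mul0r.
have hs j : j \in s -> poly_bounded (F j) by move=> js; apply: h; rewrite inE js orbT.
have hi : poly_bounded (F i) by apply: h; rewrite mem_head.
rewrite big_cons -IH // /eta_int -RintegralD //.
- by apply: eq_Rintegral => t _; rewrite big_cons mulrDr.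
- exact: integrable_eta_kernel.
- exact/integrable_eta_kernel/poly_bounded_sum.
Qed.

Lemma divpowM n i t : divpow n t * divpow i t = 'C(n + i, n)%:R * divpow (n + i) t.
Proof.
have := bin_fact (leq_addr i n); rewrite addKn => /(congr1 (fun k : nat => k%:R : R)).
rewrite !natrM /divpow => <-; rewrite exprD.
field; rewrite !pnatr_eq0 -!lt0n !fact_gt0 bin_gt0 leq_addr //.
Qed.

(** The kernel absorbs each divided power by [divpowM], which creates the binomial coefficient and
    raises the argument of eta by r - i. *)
Lemma eta_int_dpconv n r X : (forall i, poly_bounded (X i)) ->
  eta_int n (dpconv r X) =
  \sum_(i < r.+1) 'C(n + (r - i), n)%:R * eta_int (n + (r - i)) (X i).
Proof.
move=> pX; rewrite eta_int_sum => [|i _]; last exact: poly_boundedMX.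
apply: eq_bigr => i _; rewrite -eta_intZ // /eta_int.
by apply: eq_Rintegral => t _; rewrite /eta_kernel mulrA [_ / _ * divpow _ _]mulrAC divpowM; ring.
Qed.

Lemma etaE n ks : poly_bounded (polylog_expR (rev ks) : R -> R) ->
  eta ks (n.+1%:R : R) = eta_int n (polylog_expR (rev ks)).
Proof.
move=> pk; have f0 : n`!%:R != 0 :> R by rewrite pnatr_eq0 -lt0n fact_gt0.
rewrite /eta GammaE -[RHS](mulKf f0); congr (_ * _).
rewrite /eta_int -RintegralZl //; last exact: integrable_eta_kernel.
apply: eq_Rintegral => t; rewrite inE /= in_itv /= andbT => t0.
rewrite -natr1 addrK powR_mulrn ?(ltW t0) // /eta_kernel /divpow /polylog /polylog_expR.
by rewrite !mulrA [_ * t ^+ n]mulrC mulfK.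
Qed.

Lemma eta_height1 m r n :
  eta (nseq r 1%N ++ [:: m.+1]) (n.+1%:R : R) = eta_int n (height1 m r).
Proof.
have e : rev (nseq r 1%N ++ [:: m.+1]) = m.+1 :: nseq r 1%N.
  by rewrite cats1 rev_rcons rev_nseq.
by rewrite etaE e //; exact: poly_bounded_polylog.
Qed.

Lemma sum_compositions_eta m j n :
  sum_compositions (m + j.+1) j.+1 (fun ks => eta ks (n.+1%:R : R)) =
  eta_int n (sum_weight m j.+1).
Proof.
rewrite sum_compositionsE eta_int_sum => [|ks /mem_rcompsS [k [ks' ->]]]; last first.
  exact: poly_bounded_polylog.
apply: eq_big_seq => ks /mem_rcompsS [k [ks' ->]].
by rewrite etaE revK //; exact: poly_bounded_polylog.
Qed.

End Integration.

Theorem theorem2p19 (R : realType) (k p r : nat)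
    (hk : (0 < k)%N) (hp : (0 < p)%N) (hr : (0 < r)%N) :
  eta (nseq (r - 1) 1%N ++ [:: k]) (p%:R : R) =
    (-1) ^+ (r - 1) *
    \sum_(1 <= j < r.+1)
      sum_compositions (k + j - 1) j (fun ks =>
        'C(p + r - j - 1, p - 1)%:R * eta ks ((p + r - j)%:R : R))
  /\
  sum_compositions (k + r - 1) r (fun ks => eta ks (p%:R : R)) =
    (-1) ^+ (r - 1) *
    \sum_(1 <= j < r.+1)
      'C(p + r - j - 1, p - 1)%:R *
      eta (nseq (j - 1) 1%N ++ [:: k]) ((p + r - j)%:R : R).
Proof.
case: k hk => // m _; case: p hp => // n _; case: r hr => // r _.
rewrite !subn1 /=.
(* Here k, p and r have become successors and j = i + 1; the successor form of p + r - j serves both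
   the argument of eta and the binomial coefficient. *)
have idx (i : 'I_r.+1) : (n.+1 + r.+1 - i.+1 = (n + (r - i)).+1)%N.
  by have := ltn_ord i; lia.
rewrite !big_add1 !big_mkord /=; split.
- rewrite eta_height1 (eq_eta_int _ (height1_dpconv m r)).
  rewrite eta_intZ; last by apply: poly_bounded_dpconv => i; exact: poly_bounded_sum_weight.
  rewrite eta_int_dpconv; last by move=> i; exact: poly_bounded_sum_weight.
  congr (_ * _); apply: eq_bigr => i _.
  rewrite idx !subn1 /= -sum_compositions_eta.
  by rewrite /sum_compositions mulr_sumr.
- rewrite sum_compositions_eta (eq_eta_int _ (sum_weight_dpconv m r)).
  rewrite eta_intZ; last by apply: poly_bounded_dpconv => i; exact: poly_bounded_polylog.
  rewrite eta_int_dpconv; last by move=> i; exact: poly_bounded_polylog.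
  congr (_ * _); apply: eq_bigr => i _.
  by rewrite idx !subn1 /= eta_height1.
Qed.
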